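(* Let $n\ge 1$ and let $\mathrm{SSAT}(n,2^n)$ be the simple SAT instance whose $2^n$ row formulas correspond, under the translation to binary strings, exactly to the binary numbers from $0$ to $2^n-1$ (so every string of $\{0,1\}^n$ is the translation of exactly one row). Then it is an unsatisfactory board, i.e. no assignment $x\in\{0,1\}^n$ satisfies $\mathrm{SSAT}(n,2^n)$.
   Context: A simple SAT instance $\mathrm{SSAT}(n,m)$ is a conjunction of $m$ row formulas (clauses) over Boolean variables $x_{n-1},\dots,x_0$, where each row is a disjunction $\ell_{n-1}\vee\cdots\vee\ell_0$ with $\ell_i\in\{x_i,\overline{x}_i\}$ for every $i$ (every variable occurs exactly once in each row). A row is translated to the binary string $s_{n-1}\cdots s_0\in\{0,1\}^n$ with $s_i=1$ if $\ell_i=x_i$ and $s_i=0$ if $\ell_i=\overline{x}_i$; binary strings of length $n$ are identified with the numbers $0,\dots,2^n-1$. An instance is called an unsatisfactory board if no assignment of values in $\{0,1\}$ to the variables satisfies all its rows. *)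

(* Defs.v *)
From mathcomp Require Import all_boot.

Set Implicit Arguments.
Unset Strict Implicit.
Unset Printing Implicit Defensive.

(* The index i : 'I_n names the variable x_i. *)
Inductive literal (n : nat) : Type :=
  | Pos of 'I_n
  | Neg of 'I_n.

Definition assignment (n : nat) : Type := {ffun 'I_n -> bool}.

Definition eval_literal (n : nat) (x : assignment n) (l : literal n) : bool :=
  match l with
  | Pos i => x i
  | Neg i => ~~ x i
  end.

(* The disjunction l_{n-1} \/ ... \/ l_0; the second field says that l_i is
   x_i or its negation, so each variable occurs exactly once. *)
Record row_formula (n : nat) : Type := RowFormula {
  lit : 'I_n -> literal n;
  litP : forall i : 'I_n, lit i = Pos i \/ lit i = Neg i
}.

Definition eval_row (n : nat) (x : assignment n) (r : row_formula n) : bool :=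
  [exists i : 'I_n, eval_literal x (lit r i)].

Definition SSAT (n m : nat) : Type := 'I_m -> row_formula n.

Definition eval_SSAT (n m : nat) (x : assignment n) (phi : SSAT n m) : bool :=
  [forall j : 'I_m, eval_row x (phi j)].

Definition unsatisfactory_board (n m : nat) (phi : SSAT n m) : Prop :=
  forall x : assignment n, ~ eval_SSAT x phi.

Definition binary_string (n : nat) : Type := {ffun 'I_n -> bool}.

Definition translation (n : nat) (r : row_formula n) : binary_string n :=
  [ffun i => if lit r i is Pos _ then true else false].

(* The position i of a string has weight 2 ^ i: s_0 is the least significant
   bit. *)
Definition binary_number (n : nat) (s : binary_string n) : nat :=
  \sum_(i < n) s i * 2 ^ i.

(* Main.v *)
Require Import Defs.
From mathcomp Require Import all_boot.

(** The complement of an assignment [x] is the translation of some row, since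
    all strings occur; each literal of that row is false under [x]. *)

(** The hypothesis speaks of numbers, not strings: [binary_number_lt] makes the number of the
    complement an admissible [k], and [binary_number_inj] turns equality of numbers back into
    equality of strings. *)

Lemma binary_sum_recl (n : nat) (f : 'I_n.+1 -> bool) :
  \sum_(i < n.+1) f i * 2 ^ i = f ord0 + (\sum_(i < n) f (lift ord0 i) * 2 ^ i).*2.
Proof.
rewrite big_ord_recl muln1 -mul2n big_distrr /=; congr (_ + _).
by apply: eq_bigr => i _; rewrite expnS mulnCA.
Qed.

Lemma binary_number_lt (n : nat) (s : binary_string n) : binary_number s < 2 ^ n.
Proof.
(* A plain function lets the induction hypothesis apply to the shifted bits. *)
rewrite /binary_number; move: {s}(s : 'I_n -> bool).
elim: n => [|n IHn] f; first by rewrite big_ord0.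
by rewrite binary_sum_recl expnS mul2n -ltn_half_double half_bit_double.
Qed.

(** Parity recovers the lowest bit; halving leaves the number of the remaining bits. *)
Lemma binary_number_inj (n : nat) : injective (@binary_number n).
Proof.
move=> s t; rewrite /binary_number => eq_st; apply/ffunP.
move: {s t}(s : 'I_n -> bool) (t : 'I_n -> bool) eq_st.
elim: n => [|n IHn] f g; first by move=> _ [].
rewrite !binary_sum_recl => eq_fg i.
have eq0 : f ord0 = g ord0.
  by move/(congr1 odd): eq_fg; rewrite !oddD !odd_double !addbF !oddb.
have eqS := congr1 half eq_fg; rewrite !half_bit_double in eqS.
by case: (unliftP ord0 i) => [j|] ->; last exact: eq0; apply: (IHn _ _ eqS).
Qed.

(** The translation fixes only the sign of each literal; [litP] ensures that its variable is the one
    at position [i]. *)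
Lemma eval_row_complement (n : nat) (x : assignment n) (r : row_formula n) :
  translation r = [ffun i => ~~ x i] -> ~~ eval_row x r.
Proof.
move=> /ffunP tr; apply/existsPn => i; move: (tr i); rewrite !ffunE.
by case: (litP r i) => -> /=; case: (x i).
Qed.

Theorem proposition1 (n : nat) (n_ge1 : 1 <= n) (phi : SSAT n (2 ^ n))
    (all_numbers : forall k : nat, k < 2 ^ n ->
       exists! j : 'I_(2 ^ n), binary_number (translation (phi j)) = k) :
  unsatisfactory_board phi.
Proof.
move=> x /forallP sat_x.
have [j [/binary_number_inj tr_j _]] := all_numbers _ (binary_number_lt _ [ffun i => ~~ x i]).
by have := sat_x j; apply/negP; apply: eval_row_complement.
Qed.
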